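(* Let $1<p<\infty$, $p\neq2$, and let $Y$ be a finite-dimensional subspace of the real Banach space $\ell_p$. Then $Y$ has property-$(SU)$ in $\ell_p$ if and only if $Y$ is isometrically isomorphic to $\ell_p(\dim(Y))$.
   Context: $\ell_p(n)$ is $\mathbb{R}^n$ with the $\ell_p$-norm. For a closed subspace $Y$ of a Banach space $X$, $Y^\perp=\{x^*\in X^*: x^*(y)=0\ \forall y\in Y\}$. $Y$ has property-$(SU)$ in $X$ if there is a closed subspace $G$ of $X^*$ with $X^*=G\oplus Y^\perp$ such that for each $x^*\in X^*$, $\|x^*\|>\|y^\#\|$ whenever $x^*=y^\#+y^\perp$ with $y^\#\in G$ and $0\neq y^\perp\in Y^\perp$. *)

(* Defs.v *)
From HB Require Import structures.
From mathcomp Require Import all_boot all_order all_algebra.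
From mathcomp Require Import all_classical all_reals all_analysis.

Set Implicit Arguments.
Unset Strict Implicit.
Unset Printing Implicit Defensive.

Import Order.TTheory GRing.Theory Num.Theory.
Import numFieldNormedType.Exports.

Local Open Scope classical_set_scope.
Local Open Scope ring_scope.

Section lp.
Context {R : realType} (p : R).

Lemma ler1_lee1 : 1 <= p -> (1 <= p%:E)%E.
Proof. by rewrite -lee_fin. Qed.

(* Every function on [nat] is measurable and only [set0] is negligible for the
   counting measure, so no quotient is needed. *)
Definition lp (p1 : 1 <= p) : Type :=
  LfunType (@counting nat R) (ler1_lee1 p1).

Definition lpn (p1 : 1 <= p) (n : nat) : Type := 'rV[R]_n.

Section norm.
Variable p1 : 1 <= p.

Let p0 : 0 < p. Proof. exact: lt_le_trans p1. Qed.

HB.instance Definition _ := GRing.Lmodule.on (lp p1).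

Definition lp_norm (f : lp p1) : R :=
  fine (Lnorm counting p%:E (EFin \o (f : nat -> R))).

Lemma lp_normEFin f :
  (lp_norm f)%:E = Lnorm counting p%:E (EFin \o (f : nat -> R)).
Proof. exact: finite_norm_fine. Qed.

Lemma lp_norm_series f :
  (lp_norm f)%:E = ((\sum_(k <oo) (`|f k| `^ p)%:E) `^ p^-1)%E.
Proof. by rewrite lp_normEFin Lnorm_counting. Qed.

Let lp_normD f g : lp_norm (f + g) <= lp_norm f + lp_norm g.
Proof. exact: ler_LnormD. Qed.

Let lp_normZ (a : R) f : lp_norm (a *: f) = `|a| * lp_norm f.
Proof. by apply: EFin_inj; rewrite EFinM !lp_normEFin -LnormZ. Qed.

Let lp_norm_eq0 f : lp_norm f = 0 -> f = 0.
Proof.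
move=> /fine_Lnormr_eq0 [A [mA A0 fA]]; apply/LfuneqP => k.
apply: contrapT => fk.
have Ak : [set k] `<=` A by move=> _ ->; apply: fA => /= /(_ I).
have : (@counting nat R [set k] <= @counting nat R A)%E.
  exact: (le_measure counting (mem_set (I : measurable [set k])) (mem_set mA)).
rewrite [leRHS]A0 [leLHS]/counting asboolT// fset_set1 finmap.cardfs1.
by rewrite lee_fin leNgt ltr01.
Qed.

HB.instance Definition _ :=
  Lmodule_isNormed.Build R (lp p1) lp_normD lp_normZ lp_norm_eq0.

Variable n : nat.

HB.instance Definition _ := GRing.Lmodule.copy (lpn p1 n) 'rV[R]_n.

Definition lpn_norm (x : lpn p1 n) : R := (\sum_i `|x ord0 i| `^ p) `^ p^-1.

Let extend (x : lpn p1 n) (k : nat) : R :=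
  if insub k is Some i then x ord0 i else 0.

Let lpn_normE x :
  (lpn_norm x)%:E = Lnorm counting p%:E (EFin \o extend x).
Proof.
rewrite Lnorm_counting// (nneseries_split 0 n); last first.
  by move=> k _; exact: poweR_ge0.
rewrite add0n eseries0 => [|k /= nk _]; last first.
  by rewrite /extend insubN -?leqNgt// normr0 powR0// gt_eqF.
rewrite adde0 big_mkord -poweR_EFin -sumEFin; congr (_ `^ _)%E.
by apply: eq_bigr => i _; rewrite /extend /= valK.
Qed.

Let lpn_normD x y : lpn_norm (x + y) <= lpn_norm x + lpn_norm y.
Proof.
have extendD : extend (x + y) = extend x \+ extend y.
  apply/funext => k; rewrite /extend /=; case: insubP => [i _ _|_].
    by rewrite mxE.
  by rewrite addr0.
have le_norm (a b c : R) :
    a%:E = Lnorm counting p%:E (EFin \o (extend x \+ extend y)) ->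
    b%:E = Lnorm counting p%:E (EFin \o extend x) ->
    c%:E = Lnorm counting p%:E (EFin \o extend y) -> a <= b + c.
  move=> aE bE cE; rewrite -lee_fin EFinD aE bE cE.
  exact: (@eminkowski _ _ R counting (extend x) (extend y) p%:E).
apply: le_norm; [|exact: lpn_normE|exact: lpn_normE].
by rewrite -extendD; exact: lpn_normE.
Qed.

Let lpn_normZ (a : R) x : lpn_norm (a *: x) = `|a| * lpn_norm x.
Proof.
rewrite /lpn_norm; under eq_bigr => i _ do rewrite mxE normrM powRM//.
rewrite -mulr_sumr powRM ?powR_ge0 ?sumr_ge0//.
by rewrite -powRrM divff ?gt_eqF// powRr1.
Qed.

Let lpn_norm_eq0 x : lpn_norm x = 0 -> x = 0.
Proof.
move=> /powR_eq0_eq0 /eqP.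
rewrite psumr_eq0 => [/allP x0|i _]; last exact: powR_ge0.
apply/rowP => i; rewrite mxE; apply/normr0_eq0/powR_eq0_eq0/eqP.
by apply: x0; rewrite mem_index_enum.
Qed.

HB.instance Definition _ :=
  Lmodule_isNormed.Build R (lpn p1 n) lpn_normD lpn_normZ lpn_norm_eq0.

End norm.
End lp.

Section dual.
Context {R : realType} (X : normedModType R).

Definition dual_pred : {pred X -> R^o} :=
  mem [set f : X -> R^o | linear f /\ continuous f].

Record dual := Dual { dual_fun :> X -> R^o; _ : dual_fun \in dual_pred }.

HB.instance Definition _ := [isSub for dual_fun].
HB.instance Definition _ := [Choice of dual by <:].

Lemma dualP (f : dual) : linear f /\ continuous f.
Proof. by case: f => f /= /set_mem. Qed.

Lemma dual_submod_closed : submod_closed dual_pred.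
Proof.
split=> [|a f g /set_mem[lf cf] /set_mem[lg cg]]; apply/mem_set; split.
- by move=> a x y; rewrite /= scaler0 addr0.
- by move=> x; exact: cvg_cst.
- move=> b x y; rewrite !fctE lf lg !scalerDr !scalerA.
  by rewrite addrACA (mulrC a).
- move=> x; apply: cvgD; last exact: cg.
  by apply: cvgZr; exact: cf.
Qed.

HB.instance Definition _ :=
  GRing.isSubmodClosed.Build R (X -> R^o) dual_pred dual_submod_closed.
HB.instance Definition _ := [SubChoice_isSubLmodule of dual by <:].

Definition dual_norm (f : dual) : R :=
  sup [set `|f x| | x in [set x : X | `|x| <= 1]].

Lemma dual_bound (f : dual) : exists2 M, 0 < M & forall x, `|f x| <= M * `|x|.
Proof.
have [lf cf] := dualP f.
pose g : {linear X -> R^o} := HB.pack (f : X -> R^o)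
  (GRing.isLinear.Build _ _ _ _ _ lf).
have /linear_boundedP/pinfty_ex_gt0[M M0 fM] : bounded_near g (nbhs (0 : X)).
  exact/linear_bounded_continuous.
by exists M.
Qed.

Lemma dual_has_sup (f : dual) :
  has_sup [set `|f x| | x in [set x : X | `|x| <= 1]].
Proof.
split; first by exists `|f 0|, 0 => //=; rewrite normr0.
have [M M0 fM] := dual_bound f; exists M => _ [x x1 <-].
by rewrite (le_trans (fM x))// ler_piMr// ltW.
Qed.

Lemma dual_norm_ub (f : dual) x : `|x| <= 1 -> `|f x| <= dual_norm f.
Proof. by move=> x1; apply: (sup_upper_bound (dual_has_sup f)); exists x. Qed.

Let dual_normD f g : dual_norm (f + g) <= dual_norm f + dual_norm g.
Proof.
apply: ge_sup; first exact: (dual_has_sup (f + g)).1.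
move=> _ [x x1 <-]; rewrite (le_trans (ler_normD _ _))//.
by rewrite lerD// dual_norm_ub.
Qed.

Let dual_norm_le (a : R) f : dual_norm (a *: f) <= `|a| * dual_norm f.
Proof.
apply: ge_sup; first exact: (dual_has_sup (a *: f)).1.
by move=> _ [x x1 <-]; rewrite normrM ler_wpM2l// dual_norm_ub.
Qed.

Let dual_normZ (a : R) f : dual_norm (a *: f) = `|a| * dual_norm f.
Proof.
apply/le_anti; rewrite dual_norm_le/=.
have [->|a0] := eqVneq a 0.
  rewrite normr0 mul0r (le_trans _ (dual_norm_ub _ (x := 0) _))//.
  by rewrite normr0.
rewrite -ler_pdivlMl ?normr_gt0// -normfV.
by rewrite -[f in leLHS](scalerK a0) dual_norm_le.
Qed.

Let dual_norm_eq0 f : dual_norm f = 0 -> f = 0.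
Proof.
move=> f0; apply/val_inj/funext => x; have [lf cf] := dualP f.
pose g : {linear X -> R^o} := HB.pack (f : X -> R^o)
  (GRing.isLinear.Build _ _ _ _ _ lf).
have [->|x0] := eqVneq x 0; first exact: (linear0 g).
have := dual_norm_ub f (x := `|x|^-1 *: x).
have -> : f (`|x|^-1 *: x) = `|x|^-1 * f x by exact: (linearZ_LR g).
rewrite f0 normfZV// lexx => /(_ isT).
by rewrite normr_le0 mulf_eq0 invr_eq0 normr_eq0 (negbTE x0)/= => /eqP.
Qed.

HB.instance Definition _ :=
  Lmodule_isNormed.Build R dual dual_normD dual_normZ dual_norm_eq0.

End dual.

Section property_SU.
Context {R : realType} {X : normedModType R}.
Implicit Type Y : set X.

Definition annihilator Y : set (dual X) :=
  [set f | forall y, Y y -> f y = 0].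

Definition direct_sum (V : lmodType R) (G H : set V) : Prop :=
  (forall v, exists g h, [/\ G g, H h & v = g + h]) /\ G `&` H = [set 0].

Definition property_SU Y : Prop := exists G : set (dual X),
  [/\ submod_closed (mem G), closed G, direct_sum G (annihilator Y) &
      forall f g h : dual X, f = g + h -> G g -> annihilator Y h -> h != 0 ->
        `|f| > `|g|].

(* [Y] is a linear subspace of dimension [n]: it has a basis of [n] vectors. *)
Definition has_dim Y (n : nat) : Prop := exists e : 'I_n -> X,
  (forall c : 'I_n -> R, \sum_i c i *: e i = 0 -> forall i, c i = 0) /\
  Y = range (fun c : 'I_n -> R => \sum_i c i *: e i).

Definition isometrically_isomorphic Y (Z : normedModType R) : Prop :=
  exists T : {linear Z -> X}, (forall z, `|T z| = `|z|) /\ range T = Y.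

End property_SU.

(* Main.v *)
Require Import Defs.
From HB Require Import structures.
From mathcomp Require Import all_boot all_order all_algebra.
From mathcomp Require Import all_classical all_reals all_analysis.
From mathcomp Require Import ring lra.

Import Order.TTheory GRing.Theory Num.Theory.
Import numFieldNormedType.Exports.
Local Open Scope classical_set_scope.
Local Open Scope ring_scope.

(** Both properties of [Y] are equivalent to a third one,
    [has_disjoint_basis]: [Y] is spanned by [n] unit vectors with pairwise
    disjoint supports. The link is the duality map of [l_p], which sends [y] to
    the functional with coordinates [sgpow (p - 1) (y k)], that is
    [|y k| ^ (p - 1)] with the sign of [y k]. By Young's inequality this
    functional has norm [|y| ^ (p - 1)] and attains it at [y], and by smoothness
    of [|.| ^ p] it is the only functional that does so ([duality_unique]).

    Suppose that [G] is a complement of the annihilator of [Y] as in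
    property-(SU). A functional that attains its norm at a nonzero point of
    [Y] cannot have a nonzero annihilator part, so the duality map sends [Y] into
    [G], a linear space of the same dimension. Choose a basis [u] of [Y] that is dual to
    [n] coordinates of [l_p] ([dual_basis]). Comparing these coordinates shows
    that the duality map, which is not linear, nevertheless satisfies
    [duality (sum c_i u_i) = sum sgpow (p - 1) (c_i) duality (u_i)]. In each
    further coordinate this says that [sgpow (p - 1)] is additive on the values
    [c_i u_i(k)], and two nonzero values would give [2 ^ (p - 1) = 2]. Hence the
    [u_i] are disjoint ([property_SU_has_disjoint_basis]), and the span of
    disjoint unit vectors is clearly isometric to [l_p(n)].

    Conversely, an isometry maps the coordinate vectors of [l_p(n)] to disjoint
    vectors, because for [p != 2] the sum [|a + b| ^ p + |a - b| ^ p] differs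
    from [2 (|a| ^ p + |b| ^ p)], always on the same side, unless [a b = 0]
    ([isometric_has_disjoint_basis]). On disjoint vectors the duality map has
    the additivity displayed above, so the span [G] of the [duality (u_i)] is the
    image of [Y], and uniqueness of norm-attaining functionals yields the strict
    inequality of property-(SU) ([property_SU_disjoint_span]). *)

(** * Signed powers and the scalar inequalities *)

Section signed_power.
Context {R : realType}.
Implicit Types a b s t d p : R.

(** The odd extension of [t |-> t ^ s]; for [s = p - 1] it is the derivative
    of [`|t| ^ p / p], hence the coordinatewise form of the duality map of
    [l_p]. *)
Definition sgpow s t : R := Num.sg t * `|t| `^ s.

Lemma sgpow0 s : sgpow s 0 = 0.
Proof. by rewrite /sgpow sgr0 mul0r. Qed.

Lemma sgpow1 s : sgpow s 1 = 1.
Proof. by rewrite /sgpow sgr1 mul1r normr1 powR1. Qed.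

Lemma sgpowM s a b : sgpow s (a * b) = sgpow s a * sgpow s b.
Proof. by rewrite /sgpow sgrM normrM powRM// mulrACA. Qed.

Lemma sgr_sgpow s t : Num.sg (sgpow s t) = Num.sg t.
Proof.
rewrite /sgpow sgrM sgr_id; have [->|t0] := eqVneq t 0; first by rewrite sgr0 mul0r.
by rewrite (gtr0_sg (powR_gt0 _ _)) ?normr_gt0// mulr1.
Qed.

Lemma normr_sgpow s t : s != 0 -> `|sgpow s t| = `|t| `^ s.
Proof.
move=> s0; rewrite /sgpow normrM normr_sg (ger0_norm (powR_ge0 _ _)).
by have [->|t0] := eqVneq t 0; rewrite ?mul1r// normr0 powR0// mul0r.
Qed.

Lemma sgpowK s : s != 0 -> cancel (sgpow s) (sgpow s^-1).
Proof.
move=> s0 t; rewrite {1}/sgpow sgr_sgpow normr_sgpow// -powRrM divff//.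
by rewrite powRr1// -numEsg.
Qed.

Lemma sgpowVK s : s != 0 -> cancel (sgpow s^-1) (sgpow s).
Proof. by move=> s0 t; rewrite -{1}[s]invrK sgpowK// invr_eq0. Qed.

Lemma mulr_sgpow p t : 0 < p -> sgpow (p - 1) t * t = `|t| `^ p.
Proof. by move=> p0; rewrite /sgpow mulrAC -normrEsg mulr_powRB1. Qed.

(** Young's inequality for the conjugate exponents [p / (p - 1)] and [p], with
    the signs kept so that it can be summed over coordinates. *)
Lemma young_sgpow p a b : 1 < p ->
  p * (sgpow (p - 1) a * b) <= (p - 1) * `|a| `^ p + `|b| `^ p.
Proof.
move=> p1; have p0 : 0 < p by lra.
have q0 : 0 < p / (p - 1) by rewrite divr_gt0// subr_gt0.
have := @conjugate_powR R (`|a| `^ (p - 1)) `|b| (p / (p - 1)) p.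
move=> /(_ (powR_ge0 _ _) (normr_ge0 _) q0 p0).
have pn : p != 0 by lra.
have p1n : p - 1 != 0 by lra.
rewrite -powRrM (mulrC (p - 1)) divfK//.
have -> : (p / (p - 1))^-1 + p^-1 = 1 by field; rewrite p1n pn.
move=> /(_ erefl) H; rewrite mulrC -ler_pdivlMr//.
apply: le_trans (_ : `|a| `^ (p - 1) * `|b| <= _).
  apply: le_trans (ler_norm _) _.
  by rewrite normrM normr_sgpow.
apply: le_trans H _.
rewrite le_eqVlt; apply/orP; left; apply/eqP; field; by rewrite p1n pn.
Qed.

Lemma sgpow_subgradient p a b : 1 < p ->
  p * ((b - a) * sgpow (p - 1) a) <= `|b| `^ p - `|a| `^ p.
Proof.
move=> p1; have := @young_sgpow p a b p1; have := @mulr_sgpow p a.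
nra.
Qed.

(** Smoothness of [`|.| ^ p] without derivatives: [sgpow (p - 1)] is onto, so
    [d = sgpow (p - 1) e] for some [e]. Comparing the assumed subgradient at [s]
    with the true ones at [e] and at the midpoint of [s] and [e] forces
    [e = s], because [sgpow (p - 1)] is monotone and injective. *)
Lemma sgpow_subgradient_unique p s d : 1 < p ->
  (forall t, p * (t * d) <= `|s + t| `^ p - `|s| `^ p) -> d = sgpow (p - 1) s.
Proof.
move=> p1 sub_d; have p1n : p - 1 != 0 by lra.
pose e := sgpow (p - 1)^-1 d.
have de : d = sgpow (p - 1) e by rewrite /e sgpowVK.
suff h0 : e = s by rewrite de h0.
pose h := (e - s) / 2; pose m := s + h.
have em : e = m + h by rewrite /m /h; field.
(* On the three equidistant points s, m, e these four bounds squeeze d and the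
   slope at m together. *)
have H1 := sub_d h.
have H2 := @sgpow_subgradient p m s p1.
have H3 := @sgpow_subgradient p m e p1.
have H4 := @sgpow_subgradient p e m p1.
have H5 : h * (d - sgpow (p - 1) m) = 0.
  have sm : s - m = - h by rewrite /m; ring.
  have eh : e - m = h by rewrite em; ring.
  have me : m - e = - h by rewrite em; ring.
  rewrite -de in H4; rewrite -/m sm eh me in H1 H2 H3 H4.
  apply/eqP; rewrite eq_le; apply/andP; split; nra.
suff h0 : h = 0 by rewrite em h0 /m h0 !addr0.
move/eqP: H5; rewrite mulf_eq0 => /orP[/eqP//|].
rewrite subr_eq0 de => /eqP /(can_inj (sgpowK _ p1n)); rewrite em => /eqP.
by rewrite -subr_eq0 addrAC subrr add0r => /eqP.
Qed.

(** When [a] and [b] are both nonzero, the choice [c = a^-1], [d = b^-1] turns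
    the hypothesis into [2 ^ (p - 1) = 2], so this is where [p] must differ
    from [2]. *)
Lemma sgpow_additive_on_line p a b : 1 < p -> p != 2 ->
  (forall c d, sgpow (p - 1) (c * a + d * b) =
     sgpow (p - 1) c * sgpow (p - 1) a + sgpow (p - 1) d * sgpow (p - 1) b) ->
  a = 0 \/ b = 0.
Proof.
move=> p1 p2 add; have [->|a0] := eqVneq a 0; first by left.
have [->|b0] := eqVneq b 0; first by right.
have p1n : p - 1 != 0 by lra.
have := add a^-1 b^-1; rewrite -!sgpowM !mulVf// sgpow1 => H.
have : 2 `^ (p - 1) = 2 :> R.
  move: H; rewrite /sgpow gtr0_sg; last lra.
  by rewrite ger0_norm ?mul1r; last lra.
move=> /(congr1 (@ln R)); rewrite ln_powR => H2.
have l2 : ln 2 != 0 :> R by rewrite gt_eqF// ln_gt0// ltr1n.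
have : p - 1 = 1 by apply: (mulIf l2); rewrite mul1r.
move: p2 => /eqP; lra.
Qed.

Lemma powR_mean r s t : 1 < r -> 0 <= s -> 0 <= t ->
  2 * ((s + t) / 2) `^ r <= s `^ r + t `^ r.
Proof.
move=> r1 s0 t0; set m := (s + t) / 2.
have m0 : 0 <= m by rewrite /m divr_ge0// addr_ge0.
have := @sgpow_subgradient r m s r1; have := @sgpow_subgradient r m t r1.
rewrite !ger0_norm//.
have : s - m = - (t - m) by rewrite /m; field.
move=> ->; nra.
Qed.

Lemma powR_superadd r s t : 1 < r -> 0 < s -> 0 < t ->
  s `^ r + t `^ r < (s + t) `^ r.
Proof.
move=> r1 s0 t0; have r0 : 0 < r by lra.
have r10 : 0 < r - 1 by lra.
rewrite -!(@mulr_powRB1 _ _ r)//; try lra.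
rewrite mulrDl ltrD// ltr_pM2l// gt0_ltr_powR// ?nnegrE; lra.
Qed.

Lemma powR_normr2 p a : `|a| `^ p = (a ^+ 2) `^ (p / 2).
Proof.
rewrite -real_normK ?num_real// -powR_mulrn// -powRrM.
by congr (_ `^ _); field.
Qed.

(** Put [r = p / 2 > 1]. The squares of [a + b] and [a - b] have mean
    [a ^ 2 + b ^ 2], so convexity of the [r]-th power bounds the right-hand side
    below by [2 * (a ^ 2 + b ^ 2) ^ r], and the [r]-th power is strictly
    superadditive. *)
Lemma parallelogram_powR_gt p a b : 2 < p -> a != 0 -> b != 0 ->
  2 * (`|a| `^ p + `|b| `^ p) < `|a + b| `^ p + `|a - b| `^ p.
Proof.
move=> p2 a0 b0; rewrite !powR_normr2.
have r1 : 1 < p / 2 by lra.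
have a20 : 0 < a ^+ 2 by rewrite exprn_even_gt0.
have b20 : 0 < b ^+ 2 by rewrite exprn_even_gt0.
have := powR_mean _ _ _ r1 (sqr_ge0 (a + b)) (sqr_ge0 (a - b)).
have -> : ((a + b) ^+ 2 + (a - b) ^+ 2) / 2 = a ^+ 2 + b ^+ 2 by field.
apply: lt_le_trans; rewrite ltr_pM2l//; exact: powR_superadd.
Qed.

(** The same argument for [r = p / 2 < 1]: the concave [r]-th power is handled
    through its convex inverse, the [r^-1]-th power. *)
Lemma parallelogram_powR_lt p a b : 0 < p -> p < 2 -> a != 0 -> b != 0 ->
  `|a + b| `^ p + `|a - b| `^ p < 2 * (`|a| `^ p + `|b| `^ p).
Proof.
move=> p0 p2 a0 b0; rewrite !powR_normr2.
set r := p / 2; have r0 : 0 < r by rewrite /r; lra.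
have r1 : 1 < r^-1 by rewrite invf_gt1// /r; lra.
have rK x : 0 <= x -> (x `^ r) `^ r^-1 = x.
  by move=> x0; rewrite -powRrM divff ?powRr1// gt_eqF.
have rVK x : 0 <= x -> (x `^ r^-1) `^ r = x.
  by move=> x0; rewrite -powRrM mulVf ?powRr1// gt_eqF.
have a20 : 0 < a ^+ 2 by rewrite exprn_even_gt0.
have b20 : 0 < b ^+ 2 by rewrite exprn_even_gt0.
have ab0 : 0 <= a ^+ 2 + b ^+ 2 by lra.

have := powR_mean _ _ _ r1 (powR_ge0 ((a + b) ^+ 2) r) (powR_ge0 ((a - b) ^+ 2) r).
rewrite !rK ?sqr_ge0//.
have -> : (a + b) ^+ 2 + (a - b) ^+ 2 = 2 * (a ^+ 2 + b ^+ 2) by ring.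
rewrite ler_pM2l// => /(ge0_ler_powR (ltW r0)).
rewrite !nnegrE powR_ge0 ab0 => /(_ isT isT); rewrite rVK; last first.
  by rewrite divr_ge0// addr_ge0// powR_ge0.
rewrite ler_pdivrMr// mulrC => /le_lt_trans; apply; rewrite ltr_pM2l//.
have := powR_superadd _ _ _ r1 (powR_gt0 r a20) (powR_gt0 r b20).
rewrite !rK ?sqr_ge0// => /(gt0_ltr_powR r0).
rewrite !nnegrE powR_ge0 ab0 => /(_ isT isT); rewrite rVK//.
by rewrite addr_ge0// powR_ge0.
Qed.

End signed_power.

(** * Convergent series and continuous functionals *)

Section has_sum.
Context {R : realType}.
Implicit Types (u v : R^nat) (l m : R).

Definition has_sum u l : Prop := series u @ \oo --> l.

Lemma has_sum_unique u l m : has_sum u l -> has_sum u m -> l = m.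
Proof. by move=> ul um; apply: (cvg_unique _ ul um). Qed.

Lemma has_sum_ext u v l : u =1 v -> has_sum u l -> has_sum v l.
Proof. by move=> /funext ->. Qed.

Lemma has_sumD u v l m : has_sum u l -> has_sum v m -> has_sum (u \+ v) (l + m).
Proof.
move=> ul vm; rewrite /has_sum.
have -> : series (u \+ v) = series u \+ series v.
  by apply/funext => n; rewrite /series/= big_split.
exact: cvgD.
Qed.

Lemma has_sumZ u l (c : R) : has_sum u l -> has_sum (fun k => c * u k) (c * l).
Proof.
move=> ul; rewrite /has_sum.
have -> : series (fun k => c * u k) = (fun n => c * series u n).
  by apply/funext => n; rewrite /series/= mulr_sumr.
exact: cvgMr.
Qed.

Lemma has_sum_sum (I : finType) (u : I -> R^nat) (l : I -> R) :
  (forall i, has_sum (u i) (l i)) ->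
  has_sum (fun k => \sum_i u i k) (\sum_i l i).
Proof.
move=> ul; rewrite /has_sum.
have -> : series (fun k => \sum_i u i k) = (fun n => \sum_i series (u i) n).
  by apply/funext => n; rewrite /series/= exchange_big.
have -> : (fun n => \sum_i series (u i) n) = \sum_i series (u i).
  by apply/funext => n; rewrite fct_sumE.
apply: (big_ind2 (fun (f : R^nat) (x : R) => f @ \oo --> x)) => //.
- exact: cvg_cst.
- by move=> f x g y fx gy; exact: cvgD.
- by move=> i _; exact: ul.
Qed.

Lemma has_sum_le u v l m : (forall k, u k <= v k) ->
  has_sum u l -> has_sum v m -> l <= m.
Proof.
move=> uv ul vm; apply: (ler_cvg_to ul vm).
by apply: nearW => n; apply: ler_sum.
Qed.

Lemma has_sum_partial u l n : (forall k, 0 <= u k) -> has_sum u l ->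
  series u n <= l.
Proof.
move=> u0 ul; have <- := cvg_lim (@Rhausdorff R) ul.
apply: nondecreasing_cvgn_le; last by apply/cvg_ex; exists l.
apply/nondecreasing_seqP => k.
by rewrite /series/= big_nat_recr//= lerDl.
Qed.

(** Used to turn an equality between two norms into equalities in every
    coordinate. *)
Lemma has_sum_eq0 u : (forall k, 0 <= u k) -> has_sum u 0 -> forall k, u k = 0.
Proof.
move=> u0 us k; have := has_sum_partial _ _ k.+1 u0 us.
rewrite /series/= big_nat_recr//= => H; apply/eqP; rewrite eq_le u0 andbT.
by apply: le_trans H; rewrite lerDr sumr_ge0.
Qed.

Lemma has_sum_finite u n : (forall k, (n <= k)%N -> u k = 0) ->
  has_sum u (\sum_(0 <= k < n) u k).
Proof.
move=> u0; apply/cvgrPdist_le => e e0; exists n => // m /= nm.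
rewrite /series/= (big_cat_nat (leq0n n) nm)/=.
have -> : \sum_(n <= k < m) u k = 0.
  by rewrite big_nat big1// => k /andP[nk _]; exact: u0.
by rewrite addr0 subrr normr0 ltW.
Qed.

Lemma has_sum_delta k l : has_sum (fun j => l *+ (j == k)) l.
Proof.
have := @has_sum_finite (fun j => l *+ (j == k)) k.+1.
rewrite big_nat_recr//= eqxx mulr1n big_nat big1 ?add0r; last first.
  by move=> i /andP[_ ik]; rewrite ltn_eqF.
by apply => j kj; rewrite gtn_eqF.
Qed.

Lemma has_sum_dominated u v m : (forall k, `|u k| <= v k) -> has_sum v m ->
  exists l, has_sum u l.
Proof.
move=> uv vm; apply/cvg_ex; apply: normed_cvg.
apply: (@series_le_cvg R _ v) => //.
- by move=> k /=.
- by move=> k; exact: le_trans (normr_ge0 _) (uv k).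
- by apply/cvg_ex; exists m.
Qed.

End has_sum.

Section dual_theory.
Context {R : realType} {X : normedModType R}.
Implicit Types (f g : dual X) (x y : X).

Lemma dualZD f a x y : f (a *: x + y) = a * f x + f y.
Proof. by have [lf _] := dualP f; rewrite lf. Qed.

Lemma dual0 f : f 0 = 0.
Proof.
by have := dualZD f (-1) 0 0; rewrite scaler0 addr0 mulN1r addNr.
Qed.

Lemma dualZ f a x : f (a *: x) = a * f x.
Proof. by rewrite -[a *: x]addr0 dualZD dual0 addr0. Qed.

Lemma dualD f x y : f (x + y) = f x + f y.
Proof. by rewrite -{1}[x]scale1r dualZD mul1r. Qed.

Lemma dualB f x y : f (x - y) = f x - f y.
Proof. by rewrite addrC -scaleN1r dualZD mulN1r addrC. Qed.

Lemma dual_sum (I : Type) (r : seq I) (P : pred I) (x : I -> X) f :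
  f (\sum_(i <- r | P i) x i) = \sum_(i <- r | P i) f (x i).
Proof. by apply: (big_morph _ (dualD f) (dual0 f)). Qed.

Lemma dual_eqP f g : (forall x, f x = g x) -> f = g.
Proof. by move=> fg; apply/val_inj/funext. Qed.

Lemma dual_addE f g x : (f + g) x = f x + g x.
Proof. by []. Qed.

Lemma dual_subE f g x : (f - g) x = f x - g x.
Proof. by []. Qed.

Lemma dual_scaleE a f x : (a *: f) x = a * f x.
Proof. by []. Qed.

Lemma dual_sumE (I : Type) (r : seq I) (P : pred I) (f : I -> dual X) x :
  (\sum_(i <- r | P i) f i) x = \sum_(i <- r | P i) f i x.
Proof. by elim/big_ind2 : _ => // ? ? ? ? <- <-. Qed.

Lemma dual_combE n (c : 'I_n -> R) (f : 'I_n -> dual X) x :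
  (\sum_i c i *: f i) x = \sum_i c i * f i x.
Proof. by rewrite dual_sumE. Qed.

Lemma dual_norm_ge f x : `|f x| <= `|f| * `|x|.
Proof.
have [->|x0] := eqVneq x 0; first by rewrite dual0 !normr0 mulr0.
have := @dual_norm_ub _ _ f (`|x|^-1 *: x).
rewrite normrZ normfV normr_id mulVf ?normr_eq0// lexx => /(_ isT).
by rewrite dualZ normrM normfV normr_id ler_pdivrMl ?normr_gt0// mulrC.
Qed.

Lemma dual_norm_le f M : 0 <= M -> (forall x, `|f x| <= M * `|x|) -> `|f| <= M.
Proof.
move=> M0 fM; have : dual_norm f <= M; last by [].
apply: ge_sup; first exact: (dual_has_sup f).1.
move=> _ [x x1 <-].
have := fM x; have := normr_ge0 (f x); have := normr_ge0 x.
move: x1 => /=; nra.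
Qed.

End dual_theory.

(** * The norm and the coordinate vectors of l_p *)

Section lp_theory.
Context {R : realType} {p : R} {p_gt1 : 1 < p}.
Local Notation l_p := (lp (ltW p_gt1)).
Implicit Types (x y z : l_p) (f g : dual l_p).

Let p_gt0 : 0 < p. Proof. exact: lt_trans p_gt1. Qed.
Let p_neq0 : p != 0. Proof. by rewrite gt_eqF. Qed.

Lemma lp_addE x y k : (x + y) k = x k + y k. Proof. by []. Qed.
Lemma lp_scaleE (a : R) x k : (a *: x) k = a * x k. Proof. by []. Qed.
Lemma lp_subE x y k : (x - y) k = x k - y k. Proof. by []. Qed.
Lemma lp_sumE (I : Type) (r : seq I) (P : pred I) (x : I -> l_p) k :
  (\sum_(i <- r | P i) x i) k = \sum_(i <- r | P i) x i k.
Proof.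
apply: (big_ind2 (fun (z : l_p) (c : R) => z k = c)) => //.
by move=> ? ? ? ? <- <-.
Qed.

Lemma lp_combE n (c : 'I_n -> R) (u : 'I_n -> l_p) k :
  (\sum_i c i *: u i) k = \sum_i c i * u i k.
Proof. by rewrite lp_sumE. Qed.

Lemma lp_norm_has_sum x : has_sum (fun k => `|x k| `^ p) (`|x| `^ p).
Proof.
have Sx : (\sum_(k <oo) (`|x k| `^ p)%:E = (`|x| `^ p)%:E)%E.
  have := lp_norm_series x; rewrite -[lp_norm x]/`|x|.
  move=> /(congr1 (fun t => (t `^ p)%E)).
  rewrite poweR_EFin -poweRrM mulVf// poweRe1//.
  by apply: nneseries_ge0 => k _ _; rewrite lee_fin powR_ge0.
have /cvg_ex[l ul] := @is_cvg_nneseries R (fun k => (`|x k| `^ p)%:E) xpredT 0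
  (fun k _ _ => powR_ge0 _ _).
have lE := cvg_lim (@ereal_hausdorff R) ul.
rewrite Sx in lE; rewrite -lE in ul.
have fu := fine_cvg ul; rewrite /has_sum.
suff -> : series (fun k => `|x k| `^ p) =
  fine \o (fun n => \sum_(0 <= k < n) (`|x k| `^ p)%:E)%E by exact: fu.
by apply/funext => n /=; rewrite sumEFin.
Qed.

Lemma lp_norm_eq x (r : R) : 0 <= r ->
  has_sum (fun k => `|x k| `^ p) (r `^ p) -> `|x| = r.
Proof.
move=> r0 xr; have := has_sum_unique _ _ _ (lp_norm_has_sum x) xr.
move=> /(congr1 (fun t => t `^ p^-1)).
by rewrite -!powRrM divff// !powRr1.
Qed.

Lemma lp_delta_subproof k :
  (fun j => (j == k)%:R : R) \in Lfun (@counting nat R) p%:E.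
Proof.
apply/andP; rewrite !inE/=; split; first by [].
rewrite /finite_norm Lnorm_counting//.
rewrite (@eq_eseriesr _ _ (fun j => (((j == k)%:R : R) `^ p)%:E)); last first.
  by move=> j _ /=; rewrite normr_nat.
apply: poweR_lty.
have := @nneseries_split R (fun j => (((j == k)%:R : R) `^ p)%:E) 0 k.+1.
rewrite add0n => -> => [|j _]; last by rewrite lee_fin powR_ge0.
rewrite eseries0 => [|j /= kj _]; last by rewrite gtn_eqF// powR0.
by rewrite adde0 sumEFin ltry.
Qed.

Definition lp_delta k : l_p := Lfun_Sub _ (lp_delta_subproof k).

Lemma lp_deltaE k j : lp_delta k j = (j == k)%:R.
Proof. by []. Qed.

(** Moving along a coordinate vector changes one term of the series only; this
    reduces the smoothness of the norm to that of [`|.| ^ p] on the line. *)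
Lemma lp_norm_add_delta y t k :
  `|y + t *: lp_delta k| `^ p - `|y| `^ p = `|y k + t| `^ p - `|y k| `^ p.
Proof.
have H := has_sumD _ _ _ _ (lp_norm_has_sum y)
   (has_sum_delta k (`|y k + t| `^ p - `|y k| `^ p)).
have := has_sum_unique _ _ _ (lp_norm_has_sum (y + t *: lp_delta k)).
move=> /(_ (`|y| `^ p + (`|y k + t| `^ p - `|y k| `^ p))) ->; last first.
  apply: has_sum_ext H => j; rewrite lp_addE lp_scaleE lp_deltaE /=.
  have [->|jk] := eqVneq j k; first by rewrite mulr1 mulr1n addrC subrK.
  by rewrite mulr0 mulr0n !addr0.
by rewrite addrC addKr.
Qed.

Lemma lp_tail_norm x m : `|x - \sum_(k < m) x k *: lp_delta k| `^ p =
  `|x| `^ p - series (fun k => `|x k| `^ p) m.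
Proof.
pose u k := if (k < m)%N then `|x k| `^ p else 0.
have us : has_sum u (series (fun k => `|x k| `^ p) m).
  have -> : series (fun k => `|x k| `^ p) m = \sum_(0 <= k < m) u k.
    by apply: eq_big_nat => k /andP[_ km]; rewrite /u km.
  by apply: has_sum_finite => k mk; rewrite /u ltnNge mk.
have := has_sumD _ _ _ _ (lp_norm_has_sum x) (has_sumZ _ _ (-1) us).
rewrite mulN1r => H; apply: (has_sum_unique _ _ _ (lp_norm_has_sum _)).
apply: has_sum_ext H => j; rewrite lp_subE lp_sumE.
under eq_bigr => i _ do rewrite lp_scaleE lp_deltaE.
rewrite /u /=; case: (ltnP j m) => [jm|mj].
  rewrite (bigD1 (Ordinal jm))//= eqxx mulr1 big1 ?addr0; last first.
    move=> i /eqP ij; case: eqP => [ji|]; rewrite ?mulr0//.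
    by case: ij; exact: val_inj.
  by rewrite subrr normr0 powR0// mulN1r subrr.
rewrite big1 ?subr0 ?mulr0 ?addr0// => i _.
by rewrite gtn_eqF ?mulr0// (leq_trans (ltn_ord i)).
Qed.

(** The coordinate vectors are total in [l_p]: the [p]-th power of the distance
    from [x] to its truncations is the tail of a convergent series. *)
Lemma dual_lp_ext f g : (forall k, f (lp_delta k) = g (lp_delta k)) -> f = g.
Proof.
move=> fg; apply/eqP; rewrite -subr_eq0; apply/eqP/dual_eqP => x.
set h := f - g.
have h0 k : h (lp_delta k) = 0 by rewrite dual_subE fg subrr.
have hm m : `|h x| `^ p <=
    `|h| `^ p * (`|x| `^ p - series (fun k => `|x k| `^ p) m).
  rewrite -lp_tail_norm -powRM//.
  have {1}-> : h x = h (x - \sum_(k < m) x k *: lp_delta k).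
    rewrite dualB dual_sum big1 ?subr0// => k _.
    by rewrite dualZ h0 mulr0.
  rewrite ge0_ler_powR ?nnegrE ?mulr_ge0 ?(ltW p_gt0)//.
  exact: dual_norm_ge.
have : `|h x| `^ p <= 0.
  have cx : `|h| `^ p * (`|x| `^ p - series (fun k => `|x k| `^ p) m)
      @[m --> \oo] --> `|h| `^ p * (`|x| `^ p - `|x| `^ p).
    apply: cvgMr; apply: cvgB; [exact: cvg_cst|exact: lp_norm_has_sum].
  rewrite subrr mulr0 in cx; apply: (cvgr_to_ge cx).
  exact: nearW.
rewrite le_eqVlt ltNge powR_ge0 orbF => /eqP /powR_eq0_eq0 /normr0_eq0 ->.
by [].
Qed.

End lp_theory.

(** * The duality map of l_p *)

Section duality_map.
Context {R : realType} {p : R} {p_gt1 : 1 < p}.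
Local Notation l_p := (lp (ltW p_gt1)).
Implicit Types (x y z : l_p) (f g : dual l_p).

Let p_gt0 : 0 < p. Proof. exact: lt_trans p_gt1. Qed.
Let p1_neq0 : p - 1 != 0. Proof. by rewrite subr_eq0 gt_eqF. Qed.

Lemma pow_norm_split y : `|y| `^ p = `|y| `^ (p - 1) * `|y|.
Proof. by rewrite mulrC mulr_powRB1. Qed.

Definition duality_fun y : l_p -> R^o :=
  fun x => limn (series (fun k => sgpow (p - 1) (y k) * x k)).

Lemma duality_fun_has_sum y x :
  has_sum (fun k => sgpow (p - 1) (y k) * x k) (duality_fun y x).
Proof.
suff [l ul] : exists l, has_sum (fun k => sgpow (p - 1) (y k) * x k) l.
  by rewrite /duality_fun (cvg_lim (@Rhausdorff R) ul).
have H := has_sumZ _ _ p^-1 (has_sumD _ _ _ _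
  (has_sumZ _ _ (p - 1) (lp_norm_has_sum y)) (lp_norm_has_sum x)).
apply: has_sum_dominated H => k /=.
have pnorm (t : R) : p * `|t| = `|p * t| by rewrite normrM gtr0_norm.
rewrite ler_pdivlMl// pnorm ler_norml lerNl.
have := young_sgpow _ (y k) (x k) p_gt1; have := young_sgpow _ (y k) (- x k) p_gt1.
by rewrite normrN mulrN mulrN => -> ->.
Qed.

Lemma duality_funD y u v :
  duality_fun y (u + v) = duality_fun y u + duality_fun y v.
Proof.
apply: has_sum_unique (duality_fun_has_sum _ _) _.
have H := has_sumD _ _ _ _ (duality_fun_has_sum y u) (duality_fun_has_sum y v).
by apply: has_sum_ext H => k; rewrite lp_addE mulrDr.
Qed.

Lemma duality_funZ y a u : duality_fun y (a *: u) = a * duality_fun y u.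
Proof.
apply: has_sum_unique (duality_fun_has_sum _ _) _.
apply: has_sum_ext (has_sumZ _ _ a (duality_fun_has_sum y u)) => k.
by rewrite lp_scaleE mulrCA.
Qed.

Lemma duality_fun_linear y : linear (duality_fun y).
Proof. by move=> a u v; rewrite duality_funD duality_funZ. Qed.

Lemma duality_fun_young y x :
  p * duality_fun y x <= (p - 1) * `|y| `^ p + `|x| `^ p.
Proof.
have H := has_sumD _ _ _ _
  (has_sumZ _ _ (p - 1) (lp_norm_has_sum y)) (lp_norm_has_sum x).
apply: has_sum_le (has_sumZ _ _ p (duality_fun_has_sum y x)) H => k /=.
exact: young_sgpow.
Qed.

(** Hoelder's inequality for these functionals: the summed Young inequality,
    applied to the multiple of [x] that has the norm of [y]. *)
Lemma duality_fun_le y x : duality_fun y x <= `|y| `^ (p - 1) * `|x|.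
Proof.
have [->|x0] := eqVneq x 0.
  have := duality_funZ y 0 0; rewrite scale0r mul0r => ->.
  by rewrite normr0 mulr0.
have [y0|y0] := eqVneq y 0.
  suff -> : duality_fun y x = 0 by rewrite mulr_ge0// powR_ge0.
  apply: has_sum_unique (duality_fun_has_sum _ _) _.
  apply: has_sum_ext (has_sum_delta 0 0) => k /=.
  by rewrite mul0rn y0 sgpow0 mul0r.
have xp : 0 < `|x| by rewrite normr_gt0.
have yp : 0 < `|y| by rewrite normr_gt0.
have := duality_fun_young y ((`|y| / `|x|) *: x).
rewrite normrZ normrM normfV !normr_id divfK ?gt_eqF// duality_funZ.
rewrite -{2}(mul1r (`|y| `^ p)) -mulrDl subrK ler_pM2l// pow_norm_split.
by rewrite (mulrC (`|y| `^ _)) -mulrA ler_pM2l// mulrC ler_pdivrMr.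
Qed.

Lemma duality_fun_norm_le y x : `|duality_fun y x| <= `|y| `^ (p - 1) * `|x|.
Proof.
rewrite ler_norml lerNl duality_fun_le andbT -[`|x|]normrN.
apply: le_trans (duality_fun_le y (- x)).
by rewrite -[- x]scaleN1r duality_funZ mulN1r.
Qed.

Lemma duality_fun_in_dual y : duality_fun y \in @dual_pred R l_p.
Proof.
apply/mem_set; split; first exact: duality_fun_linear.
pose g : {linear l_p -> R^o} := HB.pack (duality_fun y)
  (GRing.isLinear.Build _ _ _ _ _ (duality_fun_linear y)).
apply: (@bounded_linear_continuous _ _ _ g).
apply/linear_boundedP; near=> r => x.
apply: le_trans (duality_fun_norm_le y x) _.
rewrite ler_wpM2r//.
Unshelve. all: by end_near.
Qed.

Lemma duality_exists y : {f : dual l_p |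
  forall x, has_sum (fun k => sgpow (p - 1) (y k) * x k) (f x)}.
Proof. by exists (Dual (duality_fun_in_dual y)); exact: duality_fun_has_sum. Qed.

(** The duality map of [l_p], normalized so that its coordinates are
    [sgpow (p - 1) (y k)]: it sends [y] to a functional of norm
    [`|y| ^ (p - 1)] that attains its norm at [y]. It is defined through its
    characterization so that simplification never exposes the limit behind
    it. *)
Definition duality y : dual l_p := sval (duality_exists y).

Lemma duality_has_sum y x :
  has_sum (fun k => sgpow (p - 1) (y k) * x k) (duality y x).
Proof. exact: (svalP (duality_exists y)). Qed.

Lemma duality_delta y k : duality y (lp_delta k) = sgpow (p - 1) (y k).
Proof.
apply: has_sum_unique (duality_has_sum _ _) _.
apply: has_sum_ext (has_sum_delta k (sgpow (p - 1) (y k))) => j.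
by rewrite lp_deltaE; case: eqP => [->|_]; rewrite ?mulr1 ?mulr0.
Qed.

Lemma duality_self y : duality y y = `|y| `^ p.
Proof.
apply: has_sum_unique (duality_has_sum _ _) _.
by apply: has_sum_ext (lp_norm_has_sum y) => k; rewrite mulr_sgpow.
Qed.

Lemma duality_norm_le y : `|duality y| <= `|y| `^ (p - 1).
Proof.
apply: dual_norm_le => [|x]; first exact: powR_ge0.
have -> := has_sum_unique _ _ _ (duality_has_sum y x) (duality_fun_has_sum y x).
exact: duality_fun_norm_le.
Qed.

(** Smoothness of the unit ball of [l_p]: a functional that attains its norm at
    [y] is determined. Young's inequality turns the norm bound into a subgradient
    inequality for [`|.| ^ p], which is tested along the coordinate vectors. *)
Lemma duality_unique y f : `|f| <= `|y| `^ (p - 1) -> f y = `|y| `^ p ->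
  f = duality y.
Proof.
move=> fle fy; apply: dual_lp_ext => k; rewrite duality_delta.
apply: sgpow_subgradient_unique => // t.
rewrite -lp_norm_add_delta -dualZ.
have := young_sgpow _ `|y| `|y + t *: lp_delta k| p_gt1.
rewrite /sgpow !normr_id => H.
have H2 : f (y + t *: lp_delta k) <=
    Num.sg `|y| * `|y| `^ (p - 1) * `|y + t *: lp_delta k|.
  have [y0|y0] := eqVneq y 0.
    move: fle; rewrite y0 normr0 powR0// normr_le0 => /eqP ->.
    by rewrite sgr0 !mul0r.
  rewrite gtr0_sg ?normr_gt0// mul1r.
  apply: le_trans (ler_norm _) _; apply: le_trans (dual_norm_ge _ _) _.
  by rewrite ler_wpM2r.
rewrite dualD fy in H2.
rewrite dualZ in H2 *.
have := p_gt0; nra.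
Qed.

End duality_map.

(** * Disjointly supported vectors *)

Section disjoint_families.
Context {R : realType} {p : R} {p_gt1 : 1 < p}.
Local Notation l_p := (lp (ltW p_gt1)).
Implicit Types (x y z : l_p) (f g h : dual l_p) (Y : set l_p).

Let p_gt0 : 0 < p. Proof. exact: lt_trans p_gt1. Qed.
Let p_neq0 : p != 0. Proof. by rewrite gt_eqF. Qed.

Definition disjoint_supports x y : Prop := forall k, x k = 0 \/ y k = 0.

(** Over disjointly supported vectors every map that fixes [0] acts additively
    in each coordinate; both the norm and the duality map of a combination of
    such vectors are computed by this remark. *)
Lemma sum_at_most_one_neq0 (V W : nmodType) n (F : V -> W) (a : 'I_n -> V) :
  F 0 = 0 -> (forall i j, i != j -> a i = 0 \/ a j = 0) ->
  F (\sum_i a i) = \sum_i F (a i).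
Proof.
move=> F0 a0; have [[i /eqP ai]|na] := pselect (exists i, a i <> 0).
  have aj j : j != i -> a j = 0.
    by move=> /a0[//|ai0]; rewrite ai0 eqxx in ai.
  rewrite (bigD1 i)//= [X in _ + X]big1 ?addr0//.
  by rewrite (bigD1 i)//= big1 ?addr0// => j ji; rewrite aj.
have {}a0 i : a i = 0 by apply: contrapT => ai; apply: na; exists i.
by rewrite !big1// => i _; rewrite a0.
Qed.

(** Equality in the parallelogram law for exponent [p] holds in every
    coordinate, since all coordinates contribute a defect of the same sign; a
    coordinate contributes none only where one of the two vectors vanishes. *)
Lemma parallelogram_disjoint x y : p != 2 ->
  `|x + y| `^ p + `|x - y| `^ p = 2 * (`|x| `^ p + `|y| `^ p) ->
  disjoint_supports x y.
Proof.
move=> p2 xy.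
pose d k := `|(x + y) k| `^ p + `|(x - y) k| `^ p -
            2 * (`|x k| `^ p + `|y k| `^ p).
have d0 : has_sum d 0.
  have := has_sumD _ _ _ _
    (has_sumD _ _ _ _ (lp_norm_has_sum (x + y)) (lp_norm_has_sum (x - y)))
    (has_sumZ _ _ (-2) (has_sumD _ _ _ _ (lp_norm_has_sum x) (lp_norm_has_sum y))).
  by rewrite xy mulNr subrr; apply: has_sum_ext => k /=; rewrite mulNr.
have dE k : d k = `|x k + y k| `^ p + `|x k - y k| `^ p -
            2 * (`|x k| `^ p + `|y k| `^ p) by [].
have d_axis k : x k = 0 \/ y k = 0 -> d k = 0.
  move=> [] k0; rewrite dE k0.
    by rewrite add0r sub0r normrN normr0 powR0// add0r -mulr2n mulr_natl subrr.
  by rewrite addr0 subr0 normr0 powR0// addr0 -mulr2n mulr_natl subrr.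
have [pgt|ple] := ltP 2 p.
  have dpos k : x k != 0 -> y k != 0 -> 0 < d k.
    by move=> xk yk; rewrite dE subr_gt0 parallelogram_powR_gt.
  move=> k; have [->|xk] := eqVneq (x k) 0; first by left.
  have [->|yk] := eqVneq (y k) 0; first by right.
  have := dpos k xk yk; rewrite (has_sum_eq0 d) ?ltxx// => j.
  have [xj|xj] := eqVneq (x j) 0; first by rewrite d_axis//; left.
  have [yj|yj] := eqVneq (y j) 0; first by rewrite d_axis//; right.
  exact/ltW/dpos.
have plt : p < 2 by rewrite lt_neqAle p2.
have dneg k : x k != 0 -> y k != 0 -> d k < 0.
  by move=> xk yk; rewrite dE subr_lt0 parallelogram_powR_lt.
move=> k; have [->|xk] := eqVneq (x k) 0; first by left.
have [->|yk] := eqVneq (y k) 0; first by right.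
have nd0 : has_sum (fun k => -1 * d k) 0.
  by have := has_sumZ _ _ (-1) d0; rewrite mulr0.
have := has_sum_eq0 _ _ nd0 k; rewrite mulN1r => /(_ _)/eqP.
rewrite oppr_eq0 lt_eqF ?dneg// => H; suff : false by [].
apply: H => j; rewrite mulN1r oppr_ge0.
have [xj|xj] := eqVneq (x j) 0; first by rewrite d_axis//; left.
have [yj|yj] := eqVneq (y j) 0; first by rewrite d_axis//; right.
exact/ltW/dneg.
Qed.

Section family.
Context {n : nat} {u : 'I_n -> l_p}.
Hypothesis u_disjoint : forall i j, i != j -> disjoint_supports (u i) (u j).

Lemma disjoint_sum (F : R -> R) (c : 'I_n -> R) k : F 0 = 0 ->
  F ((\sum_i c i *: u i) k) = \sum_i F (c i * u i k).
Proof.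
move=> F0; rewrite lp_sumE; apply: sum_at_most_one_neq0 => // i j ij.
rewrite !lp_scaleE.
by case: (u_disjoint i j ij k) => ->; rewrite mulr0; [left|right].
Qed.

Lemma duality_sum (c : 'I_n -> R) :
  duality (\sum_i c i *: u i) = \sum_i sgpow (p - 1) (c i) *: duality (u i).
Proof.
apply: dual_lp_ext => k; rewrite duality_delta disjoint_sum ?sgpow0// dual_combE.
by apply: eq_bigr => i _; rewrite duality_delta sgpowM.
Qed.

Hypothesis u_unit : forall i, `|u i| = 1.

Lemma disjoint_norm (c : 'I_n -> R) :
  `|\sum_i c i *: u i| = (\sum_i `|c i| `^ p) `^ p^-1.
Proof.
apply: lp_norm_eq; first exact: powR_ge0.
rewrite -powRrM mulVf// powRr1; last by apply: sumr_ge0 => i _; exact: powR_ge0.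
have := @has_sum_sum _ _ (fun i k => `|c i| `^ p * `|u i k| `^ p)
  (fun i => `|c i| `^ p * 1).
under eq_bigr do rewrite mulr1.
move=> H; apply: has_sum_ext (H _) => [k|i].
  rewrite (disjoint_sum (fun t => `|t| `^ p)) ?normr0 ?powR0//.
  by apply: eq_bigr => i _; rewrite normrM powRM.
apply: has_sumZ; have := lp_norm_has_sum (u i).
by rewrite u_unit powR1.
Qed.

Lemma duality_biorthogonal i j : duality (u i) (u j) = (i == j)%:R.
Proof.
have [<-|ij] := eqVneq i j; first by rewrite duality_self u_unit powR1.
apply: has_sum_unique (duality_has_sum _ _) _.
apply: has_sum_ext (has_sum_delta 0 0) => k; rewrite mul0rn.
by case: (u_disjoint i j ij k) => ->; rewrite ?sgpow0 ?mul0r ?mulr0.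
Qed.

End family.

Lemma dual_eval_closed x : closed [set f : dual l_p | f x = 0].
Proof.
have lin : linear (fun f : dual l_p => f x : R^o) by [].
pose ev : {linear dual l_p -> R^o} := HB.pack (fun f : dual l_p => f x : R^o)
  (GRing.isLinear.Build _ _ _ _ _ lin).
have cont : continuous ev.
  apply: bounded_linear_continuous; apply/linear_boundedP.
  near=> r => f; apply: le_trans (dual_norm_ge f x) _.
  by rewrite mulrC ler_wpM2r.
have -> : [set f : dual l_p | f x = 0] = ev @^-1` [set 0] by [].
apply: closed_comp => [f _|]; first exact: cont.
exact: closed_eq.
Unshelve. all: by end_near.
Qed.

End disjoint_families.

(** * Bases dual to finitely many coordinates *)

Section coordinates.
Context {R : realType} {p : R} {p_gt1 : 1 < p}.
Local Notation l_p := (lp (ltW p_gt1)).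
Implicit Types (Y : set l_p).

(** Induction on [m]: if fewer than [n] coordinates have been chosen, some
    nontrivial combination of the [e i] vanishes at all of them but not
    everywhere, and a coordinate where it does not vanish is independent of
    the previous ones. *)
Lemma independent_coordinates n (e : 'I_n -> l_p) m :
  (forall c : 'I_n -> R, \sum_i c i *: e i = 0 -> forall i, c i = 0) ->
  (m <= n)%N ->
  exists k : nat -> nat, row_free (\matrix_(j < m, i < n) e i (k j)).
Proof.
move=> e_free; elim: m => [|m IH] mn.
  by exists id; apply: inj_row_free => v _; apply/rowP => -[].
have [k Bfree] := IH (ltnW mn).
set B := \matrix_(j < m, i < n) e i (k j) in Bfree.
have : kermx B^T != 0.
  rewrite kermx_eq0 /row_free mxrank_tr (eqP (Bfree : \rank B == m)).
  by rewrite neq_ltn mn.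
move=> /rowV0Pn[c /sub_kermxP cB c0].
have [k0 ck0] : exists k0, \sum_i c ord0 i * e i k0 != 0.
  apply: contrapT => no; case/eqP: c0; apply/rowP => i; rewrite [RHS]mxE.
  apply: (e_free (fun i => c ord0 i)); apply/LfuneqP => j.
  rewrite lp_sumE; apply: contrapT => cj; apply: no; exists j.
  by apply/eqP.
(* The new coordinate k0 becomes row 0 of the matrix. *)
exists (fun j => if j is j'.+1 then k j' else k0).
apply: inj_row_free => v vB.
pose v' : 'rV[R]_m := \row_j v ord0 (lift ord0 j).
have split_v i : v ord0 ord0 * e i k0 + (v' *m B) ord0 i = 0.
  move/rowP/(_ i): vB; rewrite !mxE big_ord_recl !mxE/= => vB0.
  rewrite -[RHS]vB0; congr (_ + _).
  by apply: eq_bigr => j _; rewrite !mxE.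
(* Pairing a vanishing combination of rows with c kills all the old rows. *)
have v0 : v ord0 ord0 = 0.
  have : \sum_i c ord0 i * (v ord0 ord0 * e i k0 + (v' *m B) ord0 i) = 0.
    by apply: big1 => i _; rewrite split_v mulr0.
  have -> : \sum_i c ord0 i * (v ord0 ord0 * e i k0 + (v' *m B) ord0 i) =
      v ord0 ord0 * (\sum_i c ord0 i * e i k0) + (c *m (v' *m B)^T) ord0 ord0.
    rewrite [X in _ + X]mxE mulr_sumr -big_split/=; apply: eq_bigr => i _.
    by rewrite mulrDr mulrCA [_^T _ _]mxE.
  rewrite trmx_mul mulmxA cB mul0mx mxE addr0 => /eqP.
  by rewrite mulf_eq0 (negbTE ck0) orbF => /eqP.
have v'0 : v' = 0.
  apply: (row_free_inj Bfree); rewrite mul0mx; apply/rowP => i.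
  by rewrite [RHS]mxE -(split_v i) v0 mul0r add0r.
apply/rowP => j; rewrite [RHS]mxE; case: (unliftP ord0 j) => [j'|] ->//.
by move/rowP/(_ j'): v'0; rewrite !mxE.
Qed.

(** For [m = n] the coordinate matrix of the preceding lemma is invertible, and
    its inverse turns the given basis into the one dual to the coordinates. *)
Lemma dual_basis n Y : has_dim Y n ->
  exists (k : 'I_n -> nat) (u : 'I_n -> l_p),
    (forall i j, u i (k j) = (i == j)%:R) /\
    Y = range (fun c : 'I_n -> R => \sum_i c i *: u i).
Proof.
move=> [e [e_free ->]].
have [k] := independent_coordinates n e n e_free (leqnn n).
set B := \matrix_(j, i) _ => Bfree.
have Bunit : B \in unitmx by rewrite -row_free_unit.
pose u i := \sum_l invmx B l i *: e l.
have eE l : e l = \sum_(i < n) e l (k i) *: u i.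
  under eq_bigr do rewrite scaler_sumr.
  rewrite exchange_big/= (bigD1 l)//= [X in _ + X]big1 ?addr0.
    under eq_bigr do rewrite scalerA.
    rewrite -scaler_suml -[LHS]scale1r; congr (_ *: _).
    have /matrixP/(_ l l) := mulVmx Bunit; rewrite !mxE eqxx => VB; rewrite -[LHS]VB.
    by apply: eq_bigr => i _; rewrite !mxE mulrC.
  move=> m ml; under eq_bigr do rewrite scalerA.
  rewrite -scaler_suml -[RHS](scale0r (e m)); congr (_ *: _).
  have /matrixP/(_ m l) := mulVmx Bunit; rewrite !mxE (negbTE ml) => VB.
  rewrite -[RHS]VB.
  by apply: eq_bigr => i _; rewrite !mxE mulrC.
exists (fun i : 'I_n => k i), u; split.
  move=> i j; rewrite /u lp_sumE.
  have /matrixP/(_ j i) := mulmxV Bunit; rewrite !mxE eq_sym => <-.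
  by apply: eq_bigr => l _; rewrite lp_scaleE mxE mulrC.
apply/seteqP; split => _ [c _ <-].
  exists (fun i : 'I_n => \sum_l c l * e l (k i)) => //.
  under eq_bigr do rewrite scaler_suml.
  rewrite exchange_big/=; apply: eq_bigr => l _.
  rewrite [in RHS]eE scaler_sumr.
  by apply: eq_bigr => i _; rewrite scalerA.
exists (fun l => \sum_i c i * invmx B l i) => //.
under eq_bigr do rewrite scaler_suml.
rewrite exchange_big/=; apply: eq_bigr => i _.
rewrite /u scaler_sumr.
by apply: eq_bigr => l _; rewrite scalerA.
Qed.

End coordinates.

(** * Property-(SU) and disjoint bases *)

Section property_SU_lp.
Context {R : realType} {p : R} {p_gt1 : 1 < p}.
Local Notation l_p := (lp (ltW p_gt1)).
Local Notation l_pn := (lpn (ltW p_gt1)).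
Implicit Types (x y z : l_p) (f g h : dual l_p) (Y : set l_p).

Let p_gt0 : 0 < p. Proof. exact: lt_trans p_gt1. Qed.
Let p_neq0 : p != 0. Proof. by rewrite gt_eqF. Qed.
Let p1_neq0 : p - 1 != 0. Proof. by rewrite subr_eq0 gt_eqF. Qed.

Definition has_disjoint_basis Y n : Prop := exists u : 'I_n -> l_p,
  [/\ forall i j, i != j -> disjoint_supports (u i) (u j),
      forall i, `|u i| = 1 &
      Y = range (fun c : 'I_n -> R => \sum_i c i *: u i)].

Section disjoint_basis.
Context {n : nat} {u : 'I_n -> l_p}.
Hypothesis u_disjoint : forall i j, i != j -> disjoint_supports (u i) (u j).
Hypothesis u_unit : forall i, `|u i| = 1.

Let Y : set l_p := range (fun c : 'I_n -> R => \sum_i c i *: u i).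

Let u_in i : Y (u i).
Proof.
exists (fun j => (j == i)%:R) => //.
rewrite (bigD1 i)//= eqxx scale1r big1 ?addr0// => j ji.
by rewrite (negbTE ji) scale0r.
Qed.

Let u_biorth i j : duality (u i) (u j) = (i == j)%:R.
Proof. exact: duality_biorthogonal. Qed.

(* The projection onto Y parallel to the common kernel of the functionals
   duality (u i). *)
Let proj x : l_p := \sum_i duality (u i) x *: u i.

(* The span of the functionals duality (u i), written as the annihilator of the
   kernel of the projection so that it is visibly closed. *)
Let G : set (dual l_p) := [set f | forall x, f (x - proj x) = 0].

Let G_eq g : G g -> g = \sum_i g (u i) *: duality (u i).
Proof.
move=> Gg; apply: dual_eqP => x; have := Gg x.
rewrite dualB => /eqP; rewrite subr_eq0 => /eqP ->.
rewrite dual_sum dual_combE; apply: eq_bigr => i _.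
by rewrite dualZ mulrC.
Qed.

Let G_duality (c : 'I_n -> R) : G (\sum_i c i *: duality (u i)).
Proof.
move=> x; rewrite dualB dual_sum; apply/eqP; rewrite subr_eq0 dual_combE.
apply/eqP/eq_bigr => i _; rewrite dualZ dual_combE (bigD1 i)//=.
rewrite big1 => [|j ji].
  by rewrite u_biorth eqxx mulr1 addr0 mulrC.
by rewrite u_biorth (negbTE ji) mulr0.
Qed.

Let G_submod : submod_closed (mem G).
Proof.
split=> [|a f g /set_mem Gf /set_mem Gg]; apply/mem_set => x //.
by rewrite dual_addE dual_scaleE Gf Gg mulr0 addr0.
Qed.

Let G_closed : closed G.
Proof.
have -> : G = \bigcap_x [set f : dual l_p | f (x - proj x) = 0].
  by apply/seteqP; split => f Gf x; [move=> _|]; exact: Gf.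
by apply: closed_bigI => x _; exact: dual_eval_closed.
Qed.

Let G_direct : direct_sum G (annihilator Y).
Proof.
split=> [f|].
  pose g := \sum_i f (u i) *: duality (u i).
  exists g, (f - g); split; [exact: G_duality| |by rewrite subrKC].
  move=> _ [c _ <-]; rewrite dual_sum big1// => i _.
  rewrite dualZ dual_subE /g dual_combE (bigD1 i)//= big1 => [|j ji].
    by rewrite u_biorth eqxx mulr1 addr0 subrr mulr0.
  by rewrite u_biorth (negbTE ji) mulr0.
apply/seteqP; split => [f [Gf fY]|_ ->]; last by split.
by rewrite /= (G_eq _ Gf) big1// => i _; rewrite fY// scale0r.
Qed.

(** The duality map carries [Y] onto [G], so every [g] in [G] attains its norm at
    some [y] in [Y]. A perturbation of [g] by an annihilator of [Y] keeps the
    value at [y]; if it did not increase the norm, it would be the same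
    norm-attaining functional. *)
Lemma property_SU_disjoint_span : property_SU Y.
Proof.
exists G; split => // f g h fE Gg hY h0; rewrite ltNge; apply/negP => fg.
have [y [Yy gE]] : exists y, Y y /\ g = duality y.
  exists (\sum_i sgpow (p - 1)^-1 (g (u i)) *: u i); split.
    by exists (fun i => sgpow (p - 1)^-1 (g (u i))).
  rewrite (duality_sum u_disjoint) [LHS]G_eq//.
  by apply: eq_bigr => i _; rewrite sgpowVK.
have fg_eq : f = g.
  rewrite gE; apply: duality_unique.
    by apply: le_trans fg _; rewrite gE duality_norm_le.
  by rewrite fE dual_addE hY// addr0 gE duality_self.
by case/eqP: h0; apply: (addrI g); rewrite addr0 -fE.
Qed.

Lemma isometric_disjoint_span : isometrically_isomorphic Y (l_pn n).
Proof.
pose T (z : l_pn n) : l_p := \sum_i z ord0 i *: u i.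
have lin : linear T.
  move=> a z w; rewrite /T scaler_sumr -big_split/=; apply: eq_bigr => i _.
  by rewrite !mxE scalerDl scalerA.
pose TL : {linear l_pn n -> l_p} :=
  HB.pack T (GRing.isLinear.Build _ _ _ _ _ lin).
exists TL; split.
  by move=> z; exact: disjoint_norm.
apply/seteqP; split => _ [z _ <-]; first by exists (fun i => z ord0 i).
exists (\row_i z i : l_pn n) => //.
by apply: eq_bigr => i _; rewrite mxE.
Qed.

End disjoint_basis.

Lemma lpn_norm_powR n (z : l_pn n) : `|z| `^ p = \sum_i `|z ord0 i| `^ p.
Proof.
rewrite -[`|z|]/(lpn_norm z) /lpn_norm -powRrM mulVf// powRr1//.
by apply: sumr_ge0 => i _; exact: powR_ge0.
Qed.

(** Coordinate vectors of [l_p(n)] satisfy the parallelogram law for exponent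
    [p]; an isometry transports it to their images, which are thus disjoint. *)
Lemma isometric_has_disjoint_basis n Y : p != 2 ->
  isometrically_isomorphic Y (l_pn n) -> has_disjoint_basis Y n.
Proof.
move=> p2 [T [Tiso <-]].
pose d i : l_pn n := delta_mx ord0 i.
have dE i k : d i ord0 k = (k == i)%:R by rewrite /d mxE eqxx.
have TE (z : l_pn n) : `|T z| `^ p = \sum_i `|z ord0 i| `^ p.
  by rewrite Tiso; exact: lpn_norm_powR.
have entryD (z w : l_pn n) k : (z + w) ord0 k = z ord0 k + w ord0 k.
  by rewrite mxE.
have entryB (z w : l_pn n) k : (z - w) ord0 k = z ord0 k - w ord0 k.
  by rewrite !mxE.
exists (fun i => T (d i)); split.
- move=> i j ij; apply: parallelogram_disjoint => //.
  rewrite -(linearD T) -(linearB T) !TE.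
  rewrite -big_split -[X in _ = 2 * X]big_split mulr_sumr.
  apply: eq_bigr => k _.
  rewrite entryD entryB !dE /=.
  have [->|ki] := eqVneq k i.
    by rewrite (negbTE ij) mulr0n addr0 subr0 normr0 powR0// addr0 -mulr2n mulr_natl.
  rewrite mulr0n add0r sub0r normrN normr0 powR0// add0r.
  by rewrite -mulr2n mulr_natl.
- move=> i; suff : `|T (d i)| `^ p = 1.
    by move=> /(congr1 (fun t => t `^ p^-1)); rewrite -powRrM divff// powRr1// powR1.
  rewrite TE (bigD1 i)//= dE eqxx normr1 powR1 big1 ?addr0// => j ji.
  by rewrite dE (negbTE ji) normr0 powR0.
have Tz (z : l_pn n) : T z = \sum_i z ord0 i *: T (d i).
  rewrite {1}(row_sum_delta z : z = \sum_i z ord0 i *: d i) linear_sum.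
  by apply: eq_bigr => i _; rewrite linearZ.
apply/seteqP; split => _ [z _ <-]; first by exists (fun i => z ord0 i).
exists (\row_i z i : l_pn n) => //; rewrite Tz.
by apply: eq_bigr => i _; rewrite mxE.
Qed.

(** The duality map sends [Y] into the complement [G]. On a basis [u] that is
    dual to [n] coordinates, the functionals [duality (u i)] span [G] for
    dimension reasons, and reading off those coordinates gives
    [duality (sum of c i *: u i) = sum of sgpow (p - 1) (c i) *: duality (u i)].
    In any other coordinate this is an additivity of [sgpow (p - 1)] which, for
    [p != 2], is possible only if at most one [u i] is nonzero there. *)
Lemma property_SU_has_disjoint_basis n Y : p != 2 -> has_dim Y n -> property_SU Y ->
  has_disjoint_basis Y n.
Proof.
move=> p2 /dual_basis[k [u [uk YE]]] [G [G_submod _ [G_dec GY0] SU]].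
have Y_comb (c : 'I_n -> R) : Y (\sum_i c i *: u i) by rewrite YE; exists c.
have G0 : G 0 by case: G_submod => /set_mem.
have GD a f g : G f -> G g -> G (a *: f + g).
  move=> Gf Gg; case: G_submod => _ cl; apply: set_mem; apply: cl; exact: mem_set.
have G_sum (a : 'I_n -> R) (f : 'I_n -> dual l_p) :
    (forall i, G (f i)) -> G (\sum_i a i *: f i).
  move=> Gf; apply: (big_ind G) => // [f1 f2 G1 G2|i _].
    by rewrite -[f1]scale1r; exact: GD.
  by rewrite -[_ *: _]addr0; exact: GD.
(* Otherwise the G-component of duality y would have a smaller norm, yet it
   takes the same value at y, where duality y attains its norm. *)
have G_duality y : Y y -> G (duality y).
  move=> Yy; have [->|y0] := eqVneq y 0.
    suff -> : duality (0 : l_p) = 0 by [].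
    by apply: dual_lp_ext => j; rewrite duality_delta sgpow0.
  have [g [h [Gg hY E]]] : exists g h, [/\ G g, annihilator Y h & duality y = g + h].
    exact: G_dec.
  have [h0|h0] := eqVneq h 0; first by rewrite E h0 addr0.
  have lt_g := SU _ _ _ E Gg hY h0.
  have : `|y| `^ p < `|y| `^ p.
    rewrite -{1}duality_self E dual_addE hY// addr0.
    apply: le_lt_trans (ler_norm _) _; apply: le_lt_trans (dual_norm_ge _ _) _.
    rewrite pow_norm_split ltr_pM2r ?normr_gt0//.
    exact: lt_le_trans lt_g (duality_norm_le _).
  by rewrite ltxx.
have u_in i : Y (u i).
  have -> : u i = \sum_j (j == i)%:R *: u j; last exact: Y_comb.
  rewrite (bigD1 i)//= eqxx scale1r big1 ?addr0// => j ji.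
  by rewrite (negbTE ji) scale0r.
have G_ext f g : G f -> G g -> (forall i, f (u i) = g (u i)) -> f = g.
  move=> Gf Gg fg; apply/eqP; rewrite -subr_eq0; apply/eqP.
  suff : (G `&` annihilator Y) (f - g) by rewrite GY0.
  split; first by rewrite addrC -scaleN1r; exact: GD.
  rewrite YE => _ [c _ <-]; rewrite dual_sum big1// => i _.
  by rewrite dualZ dual_subE fg subrr mulr0.
(* Independence on Y of the functionals duality (u i), in matrix form; with G_ext
   it makes them a basis of G. *)
pose M := \matrix_(i, j) duality (u i) (u j).
have Mfree : row_free M.
  apply: inj_row_free => v vM.
  have v0 : \sum_i v ord0 i *: duality (u i) = 0.
    apply: G_ext => //; first by apply: G_sum => i; exact/G_duality/u_in.
    move=> j; rewrite dual_combE; move/rowP/(_ j): vM; rewrite !mxE => vM.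
    by rewrite -[RHS]vM; apply: eq_bigr => i _; rewrite mxE.
  apply/rowP => j; rewrite [RHS]mxE.
  have : (\sum_i v ord0 i *: duality (u i)) (lp_delta (k j)) = 0 by rewrite v0.
  rewrite dual_combE (bigD1 j)//= big1 => [|i ij].
    by rewrite duality_delta uk eqxx sgpow1 mulr1 addr0.
  by rewrite duality_delta uk (negbTE ij) sgpow0 mulr0.
have duality_comb (c : 'I_n -> R) :
    duality (\sum_i c i *: u i) = \sum_i sgpow (p - 1) (c i) *: duality (u i).
  set y := \sum_i _.
  pose a := (\row_j duality y (u j)) *m invmx M.
  have ya : duality y = \sum_i a ord0 i *: duality (u i).
    apply: G_ext; first exact: (G_duality _ (Y_comb c)).
      by apply: G_sum => i; exact/G_duality/u_in.
    move=> j; rewrite dual_combE.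
    have : (a *m M) ord0 j = duality y (u j).
      by rewrite /a mulmxKV ?mxE// -row_free_unit.
    rewrite mxE => <-; apply: eq_bigr => i _.
    by congr (_ * _); rewrite mxE.
  rewrite ya; apply: eq_bigr => j _; congr (_ *: _).
  have := congr1 (fun f : dual l_p => f (lp_delta (k j))) ya.
  rewrite duality_delta dual_combE (bigD1 j)//= big1 => [|i ij].
    rewrite duality_delta uk eqxx sgpow1 mulr1 addr0 => <-.
    congr (sgpow _ _); rewrite /y lp_combE (bigD1 j)//= big1 => [|i ij].
      by rewrite uk eqxx mulr1 addr0.
    by rewrite uk (negbTE ij) mulr0.
  by rewrite duality_delta uk (negbTE ij) sgpow0 mulr0.
have u_disjoint i j : i != j -> disjoint_supports (u i) (u j).
  move=> ij m; apply: (sgpow_additive_on_line _ _ _ p_gt1 p2) => c d.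
  pose e l := if l == i then c else if l == j then d else 0.
  have := congr1 (fun f : dual l_p => f (lp_delta m)) (duality_comb e).
  rewrite duality_delta lp_combE dual_combE.
  have two (F : 'I_n -> R) : (forall l, l != i -> l != j -> F l = 0) ->
      \sum_l F l = F i + F j.
    move=> F0; rewrite (bigD1 i)//= (bigD1 j) 1?eq_sym//= big1 ?addr0//.
    by move=> l /andP[li lj]; exact: F0.
  rewrite !two => [|l li lj|l li lj]; first last.
  - by rewrite /e (negbTE li) (negbTE lj) mul0r.
  - by rewrite /e (negbTE li) (negbTE lj) sgpow0 mul0r.
  rewrite !duality_delta /e !eqxx.
  by rewrite eq_sym (negbTE ij).
have u_neq0 i : `|u i| != 0.
  rewrite normr_eq0; apply/eqP => ui0.
  by have := uk i i; rewrite ui0 eqxx => /eqP; rewrite eq_sym oner_eq0.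
exists (fun i => `|u i|^-1 *: u i); split.
- move=> i j ij m; rewrite !lp_scaleE.
  by case: (u_disjoint i j ij m) => ->; rewrite mulr0; [left|right].
- by move=> i; rewrite normrZ normfV normr_id mulVf.
rewrite YE; apply/seteqP; split => _ [c _ <-].
  exists (fun i => c i * `|u i|) => //.
  by apply: eq_bigr => i _; rewrite scalerA mulfK.
exists (fun i => c i / `|u i|) => //.
by apply: eq_bigr => i _; rewrite scalerA.
Qed.

End property_SU_lp.

Theorem corollary3p7 (R : realType) (p : R) (p_gt1 : 1 < p) (p_neq2 : p != 2)
    (Y : set (lp (ltW p_gt1))) (n : nat) (Y_dim : has_dim Y n) :
  property_SU Y <-> isometrically_isomorphic Y (lpn (ltW p_gt1) n).
Proof.
split=> [SU|/(isometric_has_disjoint_basis _ _ p_neq2)[u [ud u1 ->]]].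
  have [u [ud u1 ->]] := property_SU_has_disjoint_basis _ _ p_neq2 Y_dim SU.
  exact: isometric_disjoint_span.
exact: property_SU_disjoint_span.
Qed.
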